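(* Let $\zeta_5$ be a primitive fifth root of unity. Then \[ \sum_{n=0}^\infty\sum_{m=-\infty}^\infty\overline{M}(m,n)\zeta_5^mq^n=\sum_{r=0}^4 q^r\,\overline{M}_{r,5}(q^5), \] where \begin{align*} \overline{M}_{0,5}(q)&=\frac{(q^4,q^6,q^{10};q^{10})_\infty}{(q,q^4;q^5)_\infty(q^2,q^8;q^{10})_\infty}-q(\zeta_5+\zeta_5^4)\frac{(q^2,q^8,q^{10};q^{10})_\infty}{(q^2,q^3;q^5)_\infty(q^4,q^6;q^{10})_\infty},\\ \overline{M}_{1,5}(q)&=(\zeta_5+\zeta_5^4)\frac{(q^4,q^6,q^{10};q^{10})_\infty}{(q^2,q^3;q^5)_\infty(q^2,q^8;q^{10})_\infty},\\ \overline{M}_{2,5}(q)&=-\frac{(q^{10};q^{10})_\infty}{(q,q^4;q^5)_\infty},\\ \overline{M}_{3,5}(q)&=-(\zeta_5+\zeta_5^4)\frac{(q^{10};q^{10})_\infty}{(q^2,q^3;q^5)_\infty},\\ \overline{M}_{4,5}(q)&=-\frac{(q^2,q^8,q^{10};q^{10})_\infty}{(q,q^4;q^5)_\infty(q^4,q^6;q^{10})_\infty}. \end{align*}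
   Context: $(a;q)_\infty=\prod_{k\ge0}(1-aq^k)$ and $(a_1,\dots,a_j;q)_\infty=(a_1;q)_\infty\cdots(a_j;q)_\infty$. The numbers $\overline{M}(m,n)$ are defined by \[ \sum_{n\ge0}\sum_{m}\overline{M}(m,n)z^mq^n=\frac{(-q;q)_\infty(q;q)_\infty}{(zq;q)_\infty(z^{-1}q;q)_\infty}. \] *)

(* Defs.v *)
From HB Require Import structures.
From mathcomp Require Import all_boot all_order all_algebra all_field.
Set Implicit Arguments. Unset Strict Implicit. Unset Printing Implicit Defensive.
Import Order.TTheory GRing.Theory Num.Theory.
Local Open Scope ring_scope.

Section FPS.
Variable R : comRingType.

Definition fps := nat -> R.

Definition fone : fps := fun n => if n is 0 then 1 else 0.
Definition fmono (s : nat) : fps := fun n => if n == s then 1 else 0.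
Definition fconst (c : R) : fps := fun n => if n is 0 then c else 0.
Definition fadd (f g : fps) : fps := fun n => f n + g n.
Definition fopp (f : fps) : fps := fun n => - f n.
Definition fsub (f g : fps) : fps := fun n => f n - g n.
Definition fmul (f g : fps) : fps :=
  fun n => \sum_(i < n.+1) f i * g (n - i)%N.
Definition fexp (f : fps) (k : nat) : fps := iter k (fmul f) fone.

(* Inverse of a series g with g 0 = 1:  1/g = sum_j (1 - g)^j
   (the j-th term has valuation >= j, so the coefficient of X^n only
   involves j <= n). *)
Definition finv (g : fps) : fps :=
  fun n => \sum_(j < n.+1) fexp (fsub fone g) j n.
Definition fdiv (f g : fps) : fps := fmul f (finv g).

(* Infinite product  (a; b)_oo = prod_{k >= 0} (1 - a b^k)  for series a, b
   with zero constant term: the k-th factor is 1 + O(X^(k+1)), so the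
   coefficient of X^n is that of the finite product over k <= n. *)
Definition qprod (a b : fps) : fps :=
  fun n => (\big[fmul/fone]_(k < n.+1) fsub fone (fmul a (fexp b k))) n.

Definition qp (s d : nat) : fps := qprod (fmono s) (fmono d).

Definition fsub5 (f : fps) : fps :=
  fun n => if (n %% 5 == 0)%N then f (n %/ 5)%N else 0.
End FPS.

(* The numbers Mbar(m,n):
     sum_{n,m} Mbar(m,n) z^m q^n = (-q;q)(q;q) / ((zq;q)(z^{-1}q;q)).
   The coefficient of q^n is a Laurent polynomial in z with z-degrees >= -n.
   We encode it by the polynomial z^n * [q^n] F(z,q), i.e. we substitute
   q = z t and expand in t over {poly int} (z = 'X):
     (-q;q) = (-zt; zt),  (q;q) = (zt; zt),
     (zq;q) = (z*zt; zt),  (z^{-1}q; q) = (t; zt).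
   Then Mbar(m,n) = [z^(m+n)] [t^n] F(z, zt). *)
Definition Zt : fps {poly int} := fun n => if n == 1%N then 'X else 0.
Definition Tt : fps {poly int} := fmono _ 1.
Definition Zc : fps {poly int} := fconst 'X.

Definition Mbar_gen : fps {poly int} :=
  fdiv (fmul (qprod (fopp Zt) Zt) (qprod Zt Zt))
       (fmul (qprod (fmul Zc Zt) Zt) (qprod Tt Zt)).

Definition Mbar (m : int) (n : nat) : int :=
  if (0 <= m + n%:Z)%R then (Mbar_gen n)`_(absz (m + n%:Z)) else 0.

(* coefficient of q^n in  sum_n sum_{m in Z} Mbar(m,n) z^m q^n  at z = zeta:
   Mbar(m,n) can only be nonzero for 0 <= m + n < size (Mbar_gen n),
   and this finite sum runs over exactly these m. *)
Definition Mbar_at (zeta : algC) : fps algC :=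
  fun n => \sum_(j < size (Mbar_gen n))
             (Mbar (j%:Z - n%:Z) n)%:~R * zeta ^ (j%:Z - n%:Z).

Section M5.
Variable zeta : algC.
Let c : algC := zeta + zeta ^+ 4.
Let P (s d : nat) := qp algC s d.
Let mul := @fmul algC.
Let div := @fdiv algC.

Definition Mbar05 : fps algC :=
  fsub (div (mul (P 4 10) (mul (P 6 10) (P 10 10)))
            (mul (mul (P 1 5) (P 4 5)) (mul (P 2 10) (P 8 10))))
       (mul (fconst c) (mul (fmono algC 1)
          (div (mul (P 2 10) (mul (P 8 10) (P 10 10)))
               (mul (mul (P 2 5) (P 3 5)) (mul (P 4 10) (P 6 10)))))).

Definition Mbar15 : fps algC :=
  mul (fconst c)
      (div (mul (P 4 10) (mul (P 6 10) (P 10 10)))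
           (mul (mul (P 2 5) (P 3 5)) (mul (P 2 10) (P 8 10)))).

Definition Mbar25 : fps algC :=
  fopp (div (P 10 10) (mul (P 1 5) (P 4 5))).

Definition Mbar35 : fps algC :=
  fopp (mul (fconst c) (div (P 10 10) (mul (P 2 5) (P 3 5)))).

Definition Mbar45 : fps algC :=
  fopp (div (mul (P 2 10) (mul (P 8 10) (P 10 10)))
            (mul (mul (P 1 5) (P 4 5)) (mul (P 4 10) (P 6 10)))).

Definition Mbar_r5 (r : nat) : fps algC :=
  match r with
  | 0 => Mbar05 | 1 => Mbar15 | 2 => Mbar25 | 3 => Mbar35 | _ => Mbar45
  end.
End M5.

(* Main.v *)
(** At a primitive fifth root of unity [z] the generating function equals
    [(q^2;q^2) (q;q) (z^2 q;q) (z^3 q;q) / (q^5;q^5)].  Grouping the terms of the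
    Jacobi triple product by the residue of the summation index mod 5 gives
    [(q;q) (z q;q) (q/z;q) = A + (z^2 + z^3) q B], where
    [A = (q^10,q^15,q^25;q^25)] and [B = (q^5,q^20,q^25;q^25)].  Multiplying this
    for [z] and [z^2] gives [(q;q) (q^5;q^5) = A^2 - q A B - q^2 B^2], the
    5-dissection of Euler's product without the quintuple product identity.  Its
    dilation [q -> q^2] dissects [(q^2;q^2)], the first identity (at [z^2])
    dissects the other factor, and the theorem is their product. *)

Require Import Defs.
From HB Require Import structures.
From mathcomp Require Import all_boot all_order all_algebra all_field.
From mathcomp Require Import boolp.
From mathcomp Require Import ring zify.
Set Implicit Arguments. Unset Strict Implicit. Unset Printing Implicit Defensive.
Import Order.TTheory GRing.Theory Num.Theory.
Local Open Scope ring_scope.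

(* [fingraph] also exports a [finv]. *)
Local Notation finv := Defs.finv.

(** * Formal power series as a commutative ring with its X-adic order *)

Section SeriesRing.
Variable R : comNzRingType.
Implicit Types a b f g h : fps R.

(** A coefficient of a product depends only on truncations of the factors, so commutativity and
    associativity are inherited from polynomials. *)
Definition trunc (n : nat) f : {poly R} := \poly_(i < n) f i.

Lemma fmul_trunc n i f g :
  (i < n)%N -> fmul f g i = (trunc n f * trunc n g)`_i.
Proof.
move=> lt_in; rewrite coefM; apply: eq_bigr => j _.
rewrite !coef_poly (leq_ltn_trans _ lt_in) ?leq_ord //.
by rewrite (leq_ltn_trans (leq_subr _ _) lt_in).
Qed.

Lemma fmul_trunc_fmul n f g h :
  fmul (fmul f g) h n = (trunc n.+1 f * trunc n.+1 g * trunc n.+1 h)`_n.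
Proof.
rewrite coefM /fmul; apply: eq_bigr => j _.
by rewrite -(fmul_trunc f g (ltn_ord j)) coef_poly ltnS leq_subr.
Qed.

Lemma fmulC : commutative (@fmul R).
Proof. by move=> f g; apply: funext => n; rewrite !(@fmul_trunc n.+1) // mulrC. Qed.

Lemma fmulA : associative (@fmul R).
Proof.
move=> f g h; apply: funext => n.
by rewrite fmul_trunc_fmul fmulC fmul_trunc_fmul mulrC mulrA.
Qed.

Lemma fmul1f : left_id (@fone R) (@fmul R).
Proof.
move=> f; apply: funext => n; rewrite /fmul big_ord_recl /= mul1r subn0.
by rewrite big1 ?addr0 // => i _; rewrite mul0r.
Qed.

Lemma fmulDl : left_distributive (@fmul R) (@fadd R).
Proof.
move=> f g h; apply: funext => n; rewrite /fadd /fmul -big_split.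
by apply: eq_bigr => i _; rewrite mulrDl.
Qed.

Lemma faddA : associative (@fadd R).
Proof. by move=> f g h; apply: funext => n; apply: addrA. Qed.

Lemma faddC : commutative (@fadd R).
Proof. by move=> f g; apply: funext => n; apply: addrC. Qed.

Lemma fadd0f : left_id (fun=> 0 : R) (@fadd R).
Proof. by move=> f; apply: funext => n; apply: add0r. Qed.

Lemma faddNf : left_inverse (fun=> 0 : R) (@fopp R) (@fadd R).
Proof. by move=> f; apply: funext => n; apply: addNr. Qed.

Lemma fone_neq0 : @fone R <> fun=> 0.
Proof. by move/(congr1 (@^~ 0%N))/eqP; rewrite oner_eq0. Qed.

(** Equality of functions on [nat] is undecidable, hence the classical structures. *)
HB.instance Definition _ := gen_eqMixin (fps R).
HB.instance Definition _ := gen_choiceMixin (fps R).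
HB.instance Definition _ :=
  GRing.isZmodule.Build (fps R) faddA faddC fadd0f faddNf.
HB.instance Definition _ := GRing.Zmodule_isComNzRing.Build (fps R)
  fmulA fmulC fmul1f fmulDl (introN eqP fone_neq0).

Lemma fsubE f g : fsub f g = f - g. Proof. by []. Qed.
Lemma foppE f : fopp f = - f. Proof. by []. Qed.
Lemma fmulE f g : fmul f g = f * g. Proof. by []. Qed.
Lemma fexpE f k : fexp f k = f ^+ k.
Proof. by elim: k => //= k IHk; rewrite exprS -IHk. Qed.
Lemma bigfmulE I (r : seq I) (P : pred I) (F : I -> fps R) :
  \big[@fmul R/@fone R]_(i <- r | P i) F i = \prod_(i <- r | P i) F i.
Proof. by []. Qed.

Lemma coef_fpsD f g n : (f + g) n = f n + g n. Proof. by []. Qed.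
Lemma coef_fpsN f n : (- f) n = - f n. Proof. by []. Qed.
Lemma coef_fpsM f g n : (f * g) n = \sum_(i < n.+1) f i * g (n - i)%N.
Proof. by []. Qed.
Lemma coef_fps1 n : (1 : fps R) n = (n == 0%N)%:R. Proof. by case: n. Qed.
Lemma coef_fps_sum I (r : seq I) (P : pred I) (F : I -> fps R) n :
  (\sum_(i <- r | P i) F i) n = \sum_(i <- r | P i) F i n.
Proof. by elim/big_rec2: _ => // i x y _ <-. Qed.

Lemma fconst_is_zmod_morphism : zmod_morphism (@fconst R).
Proof. by move=> x y; apply: funext => -[|n] //=;
  rewrite coef_fpsD coef_fpsN subrr. Qed.
Lemma coef_fconstM x f n : (fconst x * f) n = x * f n.
Proof.
rewrite coef_fpsM big_ord_recl /= subn0 big1 ?addr0 // => i _.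
by rewrite mul0r.
Qed.
Lemma fconst_is_monoid_morphism : monoid_morphism (@fconst R).
Proof.
split=> [|a b]; first by apply: funext => -[|n].
by apply: funext => n; rewrite coef_fconstM; case: n => //= n; rewrite mulr0.
Qed.

HB.instance Definition _ :=
  GRing.isZmodMorphism.Build R (fps R) (@fconst R) fconst_is_zmod_morphism.
HB.instance Definition _ :=
  GRing.isMonoidMorphism.Build R (fps R) (@fconst R) fconst_is_monoid_morphism.

Lemma coef_fmonoM s f n :
  (fmono R s * f) n = if (s <= n)%N then f (n - s)%N else 0.
Proof.
rewrite coef_fpsM /fmono; case: leqP => [le_sn|lt_ns].
  rewrite (bigD1 (Ordinal (le_sn : s < n.+1)%N)) //= eqxx mul1r big1 ?addr0 //.
  by move=> i; rewrite -val_eqE /= => /negPf ->; rewrite mul0r.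
rewrite big1 // => i _; rewrite ltn_eqF ?mul0r //.
exact: leq_ltn_trans (leq_ord i) lt_ns.
Qed.

Lemma fmonoM s t : fmono R s * fmono R t = fmono R (s + t).
Proof.
apply: funext => n; rewrite coef_fmonoM /fmono.
by case: leqP => ?; do ?case: eqP => ? //; lia.
Qed.

Lemma fmono0 : fmono R 0 = 1. Proof. by apply: funext => -[]. Qed.

Lemma fmonoX s k : fmono R s ^+ k = fmono R (s * k).
Proof.
elim: k => [|k IHk]; first by rewrite muln0 fmono0.
by rewrite exprS IHk fmonoM mulnS.
Qed.

(* [ford n f] reads [f = O(X^n)]. *)
Definition ford (n : nat) f := [forall i : 'I_n, f i == 0].

Lemma fordP n f : reflect (forall i, (i < n)%N -> f i = 0) (ford n f).
Proof.
apply: (iffP forallP) => [fn i lt_in|fn i]; last by rewrite fn.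
exact/eqP/(fn (Ordinal lt_in)).
Qed.

Lemma fordW m n f : (m <= n)%N -> ford n f -> ford m f.
Proof.
by move=> le_mn /fordP fn; apply/fordP => i lt_im; apply/fn/(leq_trans lt_im).
Qed.
Lemma ford_zero n : ford n 0. Proof. exact/fordP. Qed.
Lemma fordD n f g : ford n f -> ford n g -> ford n (f + g).
Proof.
move=> /fordP fn /fordP gn; apply/fordP => i lt_in.
by rewrite coef_fpsD fn ?gn ?addr0.
Qed.
Lemma fordN n f : ford n f -> ford n (- f).
Proof.
by move=> /fordP fn; apply/fordP => i lt_in; rewrite coef_fpsN fn ?oppr0.
Qed.
Lemma ford_sum n I (r : seq I) (P : pred I) (F : I -> fps R) :
  (forall i, P i -> ford n (F i)) -> ford n (\sum_(i <- r | P i) F i).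
Proof.
by move=> Fn; elim/big_rec: _ => [|i x Pi xn]; rewrite ?ford_zero ?fordD ?Fn.
Qed.
Lemma fordM m n f g : ford m f -> ford n g -> ford (m + n) (f * g).
Proof.
move=> /fordP fm /fordP gn; apply/fordP => i lt_i; rewrite coef_fpsM big1 // => j _.
case: (ltnP j m) => [/fm->|le_mj]; first by rewrite mul0r.
by rewrite gn ?mulr0 //; have := ltn_ord j; lia.
Qed.
Lemma fordMl n f g : ford n g -> ford n (f * g).
Proof. by apply: (@fordM 0); apply/fordP. Qed.
Lemma fordMr n f g : ford n f -> ford n (f * g).
Proof. by rewrite mulrC; apply: fordMl. Qed.
Lemma fordX n f k : ford n f -> ford (n * k) (f ^+ k).
Proof.
move=> fn; elim: k => [|k IHk]; first by rewrite muln0; apply/fordP.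
by rewrite mulnS exprS; apply: fordM.
Qed.
Lemma ford_expr f k : f 0%N = 0 -> ford k (f ^+ k).
Proof.
by move=> f0; rewrite -[k in ford k](mul1n k); apply/fordX/fordP => -[].
Qed.

(** X-adic separation: every identity between infinite products below is reduced to finite products
    modulo X^n through this. *)
Lemma ford_eq f g : (forall n, ford n (f - g)) -> f = g.
Proof.
move=> fg; apply/eqP; rewrite -subr_eq0; apply/eqP/funext => n.
exact: (fordP _ _ (fg n.+1)).
Qed.

Lemma ford_trans n f g h : ford n (f - g) -> ford n (g - h) -> ford n (f - h).
Proof. by move=> fg gh; rewrite -(subrKA g); apply: fordD. Qed.
Lemma ford_sym n f g : ford n (f - g) -> ford n (g - f).
Proof. by move=> fg; rewrite -opprB; apply: fordN. Qed.
Lemma ford_eqM n f f' g g' : ford n (f - f') -> ford n (g - g') ->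
  ford n (f * g - f' * g').
Proof.
move=> ff gg; rewrite (_ : _ - _ = (f - f') * g + f' * (g - g')); last by ring.
by apply: fordD; [apply: fordMr | apply: fordMl].
Qed.
Lemma finv_ford n g : g 0%N = 1 ->
  ford n (finv g - \sum_(j < n) (1 - g) ^+ j).
Proof.
move=> g0; apply/fordP => i lt_in; rewrite coef_fpsD coef_fpsN coef_fps_sum /finv.
rewrite -(subnKC lt_in) big_split_ord /=.
under eq_bigr do rewrite fexpE fsubE.
rewrite [X in _ - (_ + X)]big1 ?addr0 ?subrr // => j _.
by apply: (fordP _ _ (@ford_expr _ (i.+1 + j) _));
  [rewrite coef_fpsD coef_fpsN g0 subrr | lia].
Qed.

Lemma mul_finv g : g 0%N = 1 -> g * finv g = 1.
Proof.
move=> g0; apply: ford_eq => n.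
apply: (@ford_trans _ _ (g * \sum_(j < n) (1 - g) ^+ j)).
  by rewrite -mulrBr; apply: fordMl; apply: finv_ford.
(* The geometric sum telescopes, and 1 - g has zero constant term, so its n-th power is O(X^n). *)
rewrite (_ : _ - 1 = - (1 - g) ^+ n); last first.
  have -> : g * \sum_(j < n) (1 - g) ^+ j
    = - ((1 - g - 1) * \sum_(j < n) (1 - g) ^+ j) by ring.
  by rewrite -subrX1; ring.
by apply/fordN/ford_expr; rewrite coef_fpsD coef_fpsN g0 subrr.
Qed.

Lemma finv_uniq g h : g 0%N = 1 -> g * h = 1 -> finv g = h.
Proof.
move=> g0 gh; rewrite -[LHS]mul1r -gh [g * h]mulrC -mulrA mul_finv ?mulr1 //.
Qed.

Lemma fps_cancel g f h : g 0%N = 1 -> g * f = g * h -> f = h.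
Proof.
move=> g0 e.
by rewrite -[f]mul1r -[h]mul1r -(mul_finv g0) [g * finv g]mulrC -!mulrA e.
Qed.

Lemma ford_cancel n g f : g 0%N = 1 -> ford n (g * f) -> ford n f.
Proof.
by move=> g0 gf; rewrite -[f]mul1r -(mul_finv g0) [g * _]mulrC -mulrA;
  apply: fordMl.
Qed.

Lemma coef0_fpsM f g : (f * g) 0%N = f 0%N * g 0%N.
Proof. by rewrite coef_fpsM big_ord1. Qed.

Lemma coef0_fpsX f k : (f ^+ k) 0%N = f 0%N ^+ k.
Proof. by elim: k => // k IHk; rewrite !exprS coef0_fpsM IHk. Qed.

Lemma ford_prod_tail n m (F : nat -> fps R) : (n <= m)%N ->
    (forall k, (n <= k < m)%N -> ford n (F k - 1)) ->
  ford n (\prod_(k < m) F k - \prod_(k < n) F k).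
Proof.
elim: m => [|m IHm]; first by rewrite leqn0 => /eqP -> _; rewrite subrr ford_zero.
rewrite leq_eqVlt => /predU1P[-> _|le_nm Fn]; first by rewrite subrr ford_zero.
rewrite big_ord_recr /= -[X in _ - X]mulr1; apply: ford_eqM.
  by apply: IHm => // k /andP[nk km]; apply: Fn; rewrite nk ltnW.
by apply: Fn; rewrite -ltnS le_nm leqnn.
Qed.

(** Each coefficient of [qprod] comes from its own finite product; since b^k = O(X^k), one product
    serves for all coefficients below n. The constant term of [a] is arbitrary, which later allows
    [a = fconst z]. *)
Lemma qprod_ford n a b : b 0%N = 0 ->
  ford n (qprod a b - \prod_(k < n) (1 - a * b ^+ k)).
Proof.
move=> b0; apply/fordP => i lt_in; rewrite coef_fpsD coef_fpsN /qprod bigfmulE.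
under eq_bigr do rewrite fmulE fsubE fexpE.
apply/eqP; rewrite -oppr_eq0 opprB; apply/eqP.
apply: (fordP _ _ (@ford_prod_tail i.+1 n (fun k => 1 - a * b ^+ k) _ _)) =>
  // k /andP[ik _].
rewrite addrAC subrr add0r; apply: fordN; apply: fordMl; apply: fordW ik _.
exact: ford_expr.
Qed.

Lemma qprod_eq a b f : b 0%N = 0 ->
    (forall n, ford n (\prod_(k < n) (1 - a * b ^+ k) - f)) -> qprod a b = f.
Proof.
move=> b0 abf; apply: ford_eq => n; apply: ford_trans (abf n).
exact: qprod_ford.
Qed.

Lemma qprod0 a b : (qprod a b) 0%N = 1 - a 0%N.
Proof.
rewrite /qprod bigfmulE big_ord1 fmulE fsubE fexpE expr0 mulr1.
by rewrite coef_fpsD coef_fpsN.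
Qed.

Lemma qprod_recl a b : b 0%N = 0 -> qprod a b = (1 - a) * qprod (a * b) b.
Proof.
move=> b0; apply: qprod_eq => // -[|n]; first exact/fordP.
rewrite big_ord_recl expr0 mulr1.
rewrite -mulrBr; apply: fordMl; under eq_bigr do rewrite /bump exprS mulrA.
apply: ford_sym; apply: ford_trans (qprod_ford _ _ b0) _.
(* The last factor is 1 - a b^(n+1), which differs from 1 by O(X^(n+1)). *)
rewrite big_ord_recr /= -[X in _ - X]mulr1 -mulrBr; apply: fordMl.
rewrite addrAC subrr add0r; apply: fordN.
rewrite -mulrA -exprS; apply: fordMl.
exact: ford_expr.
Qed.
End SeriesRing.

(** * Gaussian binomials and a finite form of the Jacobi triple product *)

Section FiniteTripleProduct.
Variables (R : comNzRingType) (q : R).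

(** Gaussian binomials by a Pascal rule, hence without division. The truncated exponent is harmless
    for m > n, where [qbinom n m] is 0. *)
Fixpoint qbinom (n m : nat) : R :=
  match n, m with
  | _, 0 => 1
  | 0, _.+1 => 0
  | n.+1, m.+1 => qbinom n m.+1 + q ^+ (n - m) * qbinom n m
  end.

Definition qfact n : R := \prod_(k < n) (1 - q ^+ k.+1).

Lemma qbinom0 n : qbinom n 0 = 1. Proof. by case: n. Qed.

Lemma qbinom_small n m : (n < m)%N -> qbinom n m = 0.
Proof.
elim: n m => [|n IHn] [|m] //= lt_nm.
by rewrite !IHn ?mulr0 ?addr0 // ltnW.
Qed.

Lemma qfactS n : qfact n.+1 = qfact n * (1 - q ^+ n.+1).
Proof. exact: big_ord_recr. Qed.

Lemma qfact0 : qfact 0 = 1. Proof. exact: big_ord0. Qed.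

Lemma qbinom_fact n m : (m <= n)%N ->
  qfact m * qfact (n - m) * qbinom n m = qfact n.
Proof.
elim: n m => [|n IHn] [|m] //= le_mn; rewrite ?qfact0 ?subn0 ?mulr1 ?mul1r //.
rewrite subSS mulrDr; have := IHn m le_mn; move: le_mn.
rewrite ltnS leq_eqVlt => /predU1P[->|lt_mn] IHm.
  rewrite qbinom_small // mulr0 add0r; move: IHm.
  by rewrite subnn qfact0 expr0 mul1r !mulr1 qfactS mulrAC => ->.
have := IHn _ lt_mn; rewrite !qfactS -IHm -(subnKC lt_mn).
set d := (n - m.+1)%N; rewrite !addKn !addSn -addnS addKn !qfactS => IHm1.
have e : q ^+ (m + d.+1).+1 = q ^+ m.+1 * q ^+ d.+1 by rewrite -exprD addSn.
(* This rests on 1 - q^(m+d+2) = (1 - q^(d+1)) + q^(d+1) (1 - q^(m+1)). *)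
transitivity (qfact m * (1 - q ^+ m.+1) * qfact d * qbinom (m
  + d.+1) m.+1 * (1 - q ^+ d.+1)
  + q ^+ d.+1 * (1 - q ^+ m.+1) * (qfact m * (qfact d * (1 - q ^+ d.+1))
    * qbinom (m + d.+1) m)); first by ring.
by rewrite IHm1 e; ring.
Qed.

(* For [a * b = q] and [j = m - N] (of either sign) this is the term
   [(-1)^j a^j q^(j(j-1)/2)] of the bilateral theta series: if [j = -i < 0], it is
   [(-1)^i b^i q^(i(i-1)/2)].  One of the two truncated differences is always 0. *)
Definition theta_term (a b : R) (N m : nat) : R :=
  (-1) ^+ (m + N) * (a ^+ (m - N) * q ^+ 'C(m - N, 2)
                   * (b ^+ (N - m) * q ^+ 'C(N - m, 2))).

(** Consecutive terms have ratio -a q^(m-N); the power of q on the right keeps exponents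
    nonnegative, and for m < N the relation ab = q trades a factor b for a. This is the weight in
    the Pascal rule for [qbinom (M + N).+1 m.+1]. *)
Lemma theta_termS a b N m M : a * b = q -> (m <= M + N)%N ->
  theta_term a b N m * (- a * q ^+ M) = theta_term a b N m.+1 * q ^+ (M + N - m).
Proof.
move=> ab le_m; rewrite /theta_term addSn exprS.
case: (leqP N m) => [le_Nm|lt_mN].
  have -> : (N - m = 0)%N by lia.
  have -> : (N - m.+1 = 0)%N by lia.
  rewrite subSn // exprS binS bin1 !exprD.
  have -> : q ^+ M = q ^+ (m - N) * q ^+ (M + N - m) by rewrite -exprD;
    congr (_ ^+ _); lia.
  by ring.
have -> : (m - N = 0)%N by lia.
have -> : (m.+1 - N = 0)%N by lia.
have -> : (N - m = (N - m.+1).+1)%N by lia.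
have -> : (M + N - m = M + (N - m.+1).+1)%N by lia.
set i := (N - m.+1)%N; rewrite !exprS binS bin1 !exprD exprS.
have -> : q * q ^+ i = a * b * q ^+ i by rewrite ab.
by ring.
Qed.

Lemma finite_triple_step a b N M : a * b = q ->
  (1 - a * q ^+ M) * (\sum_(m < (M + N).+1) theta_term a b N m * qbinom (M + N) m)
  = \sum_(m < (M.+1 + N).+1) theta_term a b N m * qbinom (M.+1 + N) m.
Proof.
move=> ab; rewrite [RHS]big_ord_recl qbinom0 mulr1.
under [in RHS]eq_bigr do rewrite /= mulrDr.
rewrite big_split /= mulrBl mul1r addrA; congr (_ + _); last first.
  rewrite -mulNr mulr_sumr; apply: eq_bigr => m _.
  rewrite /bump leq0n add1n add0n [RHS]mulrA -theta_termS ?leq_ord //.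
  by ring.
under [in RHS]eq_bigr do rewrite add0n.
by rewrite big_ord_recl qbinom0 mulr1 [in RHS]big_ord_recr /= qbinom_small ?mulr0
  ?addr0.
Qed.

Lemma finite_triple_left a b N M : a * b = q ->
  (\prod_(k < M) (1 - a * q ^+ k)) * (\sum_(m < N.+1) theta_term a b N m * qbinom N m)
  = \sum_(m < (M + N).+1) theta_term a b N m * qbinom (M + N) m.
Proof.
move=> ab; elim: M => [|M IHM]; first by rewrite big_ord0 mul1r.
by rewrite -finite_triple_step // -IHM big_ord_recr /=; ring.
Qed.

(** Symmetry of [qbinom] is assumed here because its derivation from [qbinom_fact] cancels
    q-factorials, which is possible for series with [q 0 = 0]. *)
Lemma finite_triple a b M N : a * b = q ->
    (forall n m, (m <= n)%N -> qbinom n m = qbinom n (n - m)) ->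
  (\prod_(k < M) (1 - a * q ^+ k)) * \prod_(k < N) (1 - b * q ^+ k)
  = \sum_(m < (M + N).+1) theta_term a b N m * qbinom (M + N) m.
Proof.
move=> ab qbinom_sym; rewrite -finite_triple_left //; congr (_ * _).
(* With a and b exchanged and shift 0 the initial sum is the single term 1; reversing the summation
   m -> N - m exchanges them back. *)
have := @finite_triple_left b a 0 N; rewrite mulrC ab => /(_ erefl).
rewrite big_ord1 /theta_term /= bin0n !expr0 !mulr1 addn0 => ->.
rewrite (reindex_inj rev_ord_inj) /=; apply: eq_bigr => m _.
have le_m := leq_ord m; rewrite subSS [in RHS]qbinom_sym // !addn0 subn0.
have -> : (m - N = 0)%N by lia.
rewrite bin0n !expr0 !mulr1 !mul1r; congr (_ * _ * _).
by rewrite -signr_odd -[RHS]signr_odd oddB // oddD addbC.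
Qed.
End FiniteTripleProduct.

(** * The Jacobi triple product as an X-adic limit *)

Section TripleProduct.
Variable R : comNzRingType.
Implicit Types a b q : fps R.

Lemma qfact_coef0 q n : q 0%N = 0 -> (qfact q n) 0%N = 1.
Proof.
move=> q0; elim: n => [|n IHn]; first by rewrite qfact0.
rewrite qfactS coef0_fpsM IHn mul1r coef_fpsD coef_fpsN coef0_fpsX q0.
by rewrite expr0n subr0.
Qed.

Lemma qbinom_sym q n m : q 0%N = 0 -> (m <= n)%N ->
  qbinom q n m = qbinom q n (n - m).
Proof.
move=> q0 le_mn.
apply: (@fps_cancel _ (qfact q m * qfact q (n - m))).
  by rewrite coef0_fpsM !qfact_coef0 ?mulr1.
by rewrite qbinom_fact // [qfact q m * _]mulrC -{2}(subKn le_mn) qbinom_fact ?leq_subr.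
Qed.


Lemma qprod_const_ford q n m a : q 0%N = 0 -> (n <= m)%N ->
  ford n (\prod_(k < m) (1 - a * q ^+ k) - qprod a q).
Proof.
move=> q0 le_nm; apply: ford_sym; apply: fordW le_nm _; exact: qprod_ford.
Qed.

(** One order better than [qprod_ford], as the first omitted factor is 1 - q^(n+1). *)
Lemma qfact_ford q n : q 0%N = 0 -> ford n.+1 (qfact q n - qprod q q).
Proof.
move=> q0; apply: ford_sym; apply: ford_trans (qprod_ford n.+1 q q0) _.
rewrite big_ord_recr /= -[X in _ - X]mulr1 /qfact.
under [X in _ - X * 1]eq_bigr do rewrite exprS.
rewrite -mulrBr; apply: fordMl; rewrite addrAC subrr add0r -exprS.
exact/fordN/ford_expr.
Qed.

(** In [qbinom_fact] all three q-factorials are close to (q;q), one copy of which cancels. *)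
Lemma qbinom_ford q m n : q 0%N = 0 ->
  ford (minn m n).+1 (qprod q q * qbinom q (m + n) m - 1).
Proof.
move=> q0; set E := qprod q q.
have E0 : E 0%N = 1 by rewrite /E qprod0 q0 subr0.
apply: (ford_cancel E0).
have := qbinom_fact q (leq_addr n m); rewrite addKn => e.
rewrite mulrBr mulr1 mulrA; apply: (@ford_trans _ _ _ (qfact q (m + n))).
  rewrite -e; apply: ford_eqM; last by rewrite subrr ford_zero.
  by apply: ford_eqM; apply: ford_sym; (apply: fordW; last exact: qfact_ford);
    rewrite ltnS ?geq_minl ?geq_minr.
by apply: fordW; last exact: qfact_ford; lia.
Qed.

(** Uses C(k,2) >= k - 1; the order lost here is regained from the successor in [qbinom_ford]. *)
Lemma theta_term_ford q a b N m : q 0%N = 0 ->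
  ford ((m - N) + (N - m)).-1 (theta_term q a b N m).
Proof.
move=> q0; apply: fordMl.
have bin_ge k : (k.-1 <= 'C(k, 2))%N.
  by case: k => // k; rewrite binS bin1 leq_addl.
case: (leqP N m) => [/eqP -> | /ltnW/eqP ->].
  by rewrite addn0; apply/fordMr/fordMl/(fordW (bin_ge _))/ford_expr.
by rewrite add0n; apply/fordMl/fordMl/(fordW (bin_ge _))/ford_expr.
Qed.

(** In the finite identity the weights (q;q) [qbinom] are replaced by 1: the error is small in the
    middle of the range by [qbinom_ford] and near its ends by [theta_term_ford]. *)
Lemma triple_product q a b M N : q 0%N = 0 -> a * b = q ->
  ford (minn M N) (qprod q q * (qprod a q * qprod b q)
                   - \sum_(m < (M + N).+1) theta_term q a b N m).
Proof.
move=> q0 ab; apply: (@ford_trans _ _ _ (qprod q q *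
    \sum_(m < (M + N).+1) theta_term q a b N m * qbinom q (M + N) m)).
  rewrite -finite_triple //; last by move=> *; apply: qbinom_sym.
  apply: ford_eqM; first by rewrite subrr ford_zero.
  by apply: ford_eqM; apply: ford_sym; apply: qprod_const_ford => //;
    rewrite ?geq_minl ?geq_minr.
rewrite mulr_sumr -sumrB; apply: ford_sum => m _.
have le_m := leq_ord m.
rewrite mulrCA -[X in _ - X]mulr1 -mulrBr.
have := fordM (theta_term_ford a b N m q0) (qbinom_ford m (M + N - m) q0).
by rewrite subnKC //; apply: fordW; lia.
Qed.
End TripleProduct.

(** * Dissection of theta series modulo 5 *)

Lemma big_ord_mul (T : Type) (idx : T) (op : Monoid.law idx) n d (F : nat -> T) :
  \big[op/idx]_(m < n * d) F m
  = \big[op/idx]_(k < n) \big[op/idx]_(r < d) F (k * d + r)%N.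
Proof.
elim: n => [|n IHn]; first by rewrite !big_ord0.
by rewrite mulSnr big_split_ord big_ord_recr /= IHn.
Qed.

(* With [m = k * 5 + r] and [N = 5 * K + 1], the summation index [m - N] is
   [5 (k - K) + (r - 1)]: the residues are taken in [-1 .. 3], so that the inner
   series have nonnegative exponents. *)
Lemma dissection_exponent k K r : (r < 5)%N ->
  ('C(k * 5 + r - (5 * K).+1, 2)
     + ((5 * K).+1 - (k * 5 + r) + 'C((5 * K).+1 - (k * 5 + r), 2))
  = ('C(r, 2).+1 - r)
     + ((5 + 5 * r) * (k - K) + 25 * 'C(k - K, 2)
        + ((20 - 5 * r) * (K - k) + 25 * 'C(K - k, 2))))%N.
Proof.
move=> lt_r5.
have bin2E n : (2 * 'C(n, 2) + n = n * n)%N.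
  by rewrite -(mul_bin_diag n 1) bin1; case: n => // n; rewrite -mulnSr.
have bin2_5 i c : 'C(5 * i + c, 2) = (25 * 'C(i, 2) + (10 + 5 * c) * i + 'C(c, 2))%N.
  have := bin2E (5 * i + c)%N; have := bin2E i; have := bin2E c; nia.
have bin2S n : 'C(n.+1, 2) = ('C(n, 2) + n)%N by rewrite binS bin1.
have bin2_0 : 'C(0, 2) = 0%N by [].
have bin2_1 : 'C(1, 2) = 0%N by [].
have bin2_2 : 'C(2, 2) = 1%N by [].
have bin2_3 : 'C(3, 2) = 3%N by [].
have bin2_4 : 'C(4, 2) = 6%N by [].
case: (leqP K k) => [le_Kk | lt_kK].
  have [i ->] : exists i, k = (K + i)%N by exists (k - K)%N; lia.
  have -> : (K + i - K = i)%N by lia.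
  have -> : (K - (K + i) = 0)%N by lia.
  case: r lt_r5 => [|r] lt_r5.
    (* For K <= k, only k = K with r = 0 gives a negative index m - N, namely -1. *)
    case: i => [|i].
      have -> : ((K + 0) * 5 + 0 - (5 * K).+1 = 0)%N by lia.
      by have -> : ((5 * K).+1 - ((K + 0) * 5 + 0) = 1)%N by lia.
    have -> : ((K + i.+1) * 5 + 0 - (5 * K).+1 = 5 * i + 4)%N by lia.
    have -> : ((5 * K).+1 - ((K + i.+1) * 5 + 0) = 0)%N by lia.
    rewrite bin2_5 bin2_4 binS bin1 !bin0n; lia.
  have -> : ((K + i) * 5 + r.+1 - (5 * K).+1 = 5 * i + r)%N by lia.
  have -> : ((5 * K).+1 - ((K + i) * 5 + r.+1) = 0)%N by lia.
  by rewrite bin2_5 binS bin1 bin0n; case: r lt_r5 => [|[|[|[|r]]]] //= _;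
    rewrite ?bin2_2 ?bin2_3 ?bin0n ?bin1n; lia.
have [j ->] : exists j, K = (k + j.+1)%N by exists (K - k.+1)%N; lia.
have -> : (k + j.+1 - k = j.+1)%N by lia.
have -> : (k - (k + j.+1) = 0)%N by lia.
have -> : (k * 5 + r - (5 * (k + j.+1)).+1 = 0)%N by lia.
case: r lt_r5 => [|[|[|[|[|r]]]]] //= _.
- have -> : ((5 * (k + j.+1)).+1 - (k * 5 + 0) = 5 * j.+1 + 1)%N by lia.
  rewrite bin2_5 ?bin2_0 ?bin2_1; lia.
- have -> : ((5 * (k + j.+1)).+1 - (k * 5 + 1) = 5 * j.+1 + 0)%N by lia.
  rewrite bin2_5 ?bin2_0 ?bin2_1; lia.
- have -> : ((5 * (k + j.+1)).+1 - (k * 5 + 2) = 5 * j + 4)%N by lia.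
  rewrite bin2_5 bin2_4 bin2_2 (bin2S j) bin2_0; lia.
- have -> : ((5 * (k + j.+1)).+1 - (k * 5 + 3) = 5 * j + 3)%N by lia.
  rewrite bin2_5 bin2_3 (bin2S j) bin2_0; lia.
have -> : ((5 * (k + j.+1)).+1 - (k * 5 + 4) = 5 * j + 2)%N by lia.
rewrite bin2_5 bin2_2 bin2_4 (bin2S j) bin2_0; lia.
Qed.

Section Dissection.
Variable F : fieldType.
Local Notation X := (fmono F 1).

Lemma theta_term_mono s t (z w : F) d N m : 
  theta_term (fmono F d) (fconst z * fmono F s) (fconst w * fmono F t) N m
  = (-1) ^+ (m + N) * fconst (z ^+ (m - N) * w ^+ (N - m))
    * fmono F ((s * (m - N) + d * 'C(m - N, 2)) + (t * (N - m) + d * 'C(N - m, 2))).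
Proof.
rewrite /theta_term !exprMn !fmonoX -!rmorphXn rmorphM -!fmonoM /=.
ring.
Qed.

(** As z^5 = 1, the power of z depends only on r: z^(r-1), written z^(r+4). The monomial has
    exponent (r-1)(r-2)/2, and the rest is a theta term in q^25. *)
Lemma theta_term_dissection (z : F) K k r : z ^+ 5 = 1 -> (r < 5)%N ->
  theta_term X (fconst z) (fconst (z ^+ 4) * X) (5 * K).+1 (k * 5 + r)
  = (-1) ^+ r.+1 * fconst (z ^+ (r + 4)) * fmono F ('C(r, 2).+1 - r)
    * theta_term (fmono F 25) (fmono F (5 + 5 * r)) (fmono F (20 - 5 * r)) K k.
Proof.
move=> z5 lt_r5.
have := @theta_term_mono 0 1 z (z ^+ 4) 1 (5 * K).+1 (k * 5 + r).
rewrite fmono0 mulr1 => ->.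
have := @theta_term_mono (5 + 5 * r) (20 - 5 * r) 1 1 25 K k.
rewrite rmorph1 !mul1r !expr1n mulr1 rmorph1 mulr1 => ->.
rewrite mul0n add0n !mul1n dissection_exponent // -fmonoM.
rewrite -exprM -exprD.
have -> : fconst (z ^+ (k * 5 + r - (5 * K).+1 + 4 * ((5 * K).+1 - (k * 5 + r))))
   = fconst (z ^+ (r + 4)).
  rewrite -(expr_mod _ z5) -[in RHS](expr_mod _ z5); congr (fconst (_ ^+ _)); lia.
have -> : (-1) ^+ (k * 5 + r + (5 * K).+1) = (-1) ^+ r.+1 * (-1) ^+ (k + K) :> fps F.
  rewrite -exprD -signr_odd -[RHS]signr_odd; congr (_ ^+ nat_of_bool _).
  lia.
ring.
Qed.

(** The triple product is applied with a = z and b = q/z, so that ab = q; it yields this identity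
    times 1 - z. *)
Lemma theta_dissection (z : F) : z ^+ 5 = 1 -> z != 1 ->
  qp F 1 1 * (qprod (fconst z * X) X * qprod (fconst (z ^+ 4) * X) X)
  = qp F 25 25 * (qp F 10 25 * qp F 15 25)
    + fconst (z ^+ 2 + z ^+ 3) * X * (qp F 25 25 * (qp F 5 25 * qp F 20 25)).
Proof.
move=> z5 z1.
pose G r := qp F 25 25 * (qp F (5 + 5 * r) 25 * qp F (20 - 5 * r) 25).
pose c r : fps F := (-1) ^+ r.+1 * fconst (z ^+ (r + 4)) * fmono F ('C(r, 2).+1 - r).
have zX : z * z ^+ 4 = 1 by rewrite -exprS.
have key : qprod X X * (qprod (fconst z) X * qprod (fconst (z ^+ 4) * X) X)
  = \sum_(r < 5) c r * G r.
  apply: ford_eq => K.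
  (* These bounds give 5(2K + 1) terms, that is 2K + 1 full blocks of residues -1..3. *)
  apply: (@ford_trans _ _ _ (\sum_(m < ((5 * K).+3 + (5 * K).+1).+1)
     theta_term X (fconst z) (fconst (z ^+ 4) * X) (5 * K).+1 m)).
    apply: fordW (triple_product _ _ _ _); first by lia.
      by [].
    by rewrite mulrA -rmorphM zX rmorph1 mul1r.
  have -> : (((5 * K).+3 + (5 * K).+1).+1 = (K + K).+1 * 5)%N by lia.
  rewrite (@big_ord_mul _ _ _ _ _ (theta_term X (fconst z) (fconst (z ^+ 4)
    * X) (5 * K).+1)).
  rewrite exchange_big -sumrB; apply: ford_sum => r _ /=.
  under eq_bigr do rewrite theta_term_dissection //.
  rewrite -mulr_sumr -mulrBr; apply/fordMl/ford_sym.
  have := @triple_product F (fmono F 25) (fmono F (5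
    + 5 * r)) (fmono F (20 - 5 * r)) K K.
  rewrite minnn; apply=> //; rewrite fmonoM; congr fmono; have := ltn_ord r; lia.
(* the class [r = 4] vanishes: its inner series is a theta series at [b = 1] *)
have q0 : qp F 0 25 = 0.
  by rewrite /qp fmono0 qprod_recl // subrr mul0r.
have z6 : z ^+ 6 = z by rewrite exprS z5 mulr1.
have z7 : z ^+ 7 = z ^+ 2 by rewrite (exprD z 2 5) z5 mulr1.
move: key; rewrite (@qprod_recl _ (fconst z)) // !big_ord_recr big_ord0 /G /c /=.
rewrite -[qp F (20 - 5 * 4) 25]/(qp F 0 25) q0 !mulr0 addr0 add0r [z ^+ (1
  + 4)]z5 [z ^+ (2 + 4)]z6 [z ^+ (3 + 4)]z7.
rewrite -[fmono F ('C(0, 2).+1 - 0)]/X -[fmono F ('C(3, 2).+1 - 3)]/X.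
rewrite -[fmono F ('C(1, 2).+1 - 1)]/(fmono F 0)
  -[fmono F ('C(2, 2).+1 - 2)]/(fmono F 0).
rewrite fmono0 -[qp F (5 + 5 * 0) 25]/(qp F 5 25) -[qp F (5 + 5 * 1) 25]/(qp F 10 25).
rewrite -[qp F (5 + 5 * 2) 25]/(qp F 15 25) -[qp F (5 + 5 * 3) 25]/(qp F 20 25).
rewrite -[qp F (20 - 5 * 0) 25]/(qp F 20 25) -[qp F (20 - 5 * 1) 25]/(qp F 15 25).
rewrite -[qp F (20 - 5 * 2) 25]/(qp F 10 25) -[qp F (20 - 5 * 3) 25]/(qp F 5 25).
rewrite -[qprod X X]/(qp F 1 1) !rmorphD !rmorphXn rmorph1 /= => key.
(* The classes r = 1, 2 contribute 1 - z, and r = 0, 3 contribute z^2 - z^4 = (1 - z)(z^2 + z^3);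
   the constant 1 - z is then cancelled. *)
have inv1z : fconst ((1 - z)^-1) * (1 - fconst z) = 1.
  by rewrite -(rmorph1 (@fconst F)) -rmorphB -rmorphM mulVf // subr_eq0 eq_sym.
rewrite -[LHS]mul1r -[RHS]mul1r -inv1z -[LHS]mulrA -[RHS]mulrA; congr (_ * _).
rewrite [LHS](_ : _ = qp F 1 1 * ((1 - fconst z) * qprod (fconst z * X) X *
   qprod (fconst z ^+ 4 * X) X)); last by ring.
by rewrite key; ring.
Qed.
End Dissection.

(** * Continuous morphisms of series: dilation and twist *)

Lemma ford_eq_prod (R : comNzRingType) n I (r : seq I) (A B : I -> fps R) :
    (forall i, ford n (A i - B i)) ->
  ford n (\prod_(i <- r) A i - \prod_(i <- r) B i).
Proof.
move=> AB; elim/big_rec2: _ => [|i x y _ xy]; first by rewrite subrr ford_zero.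
exact: ford_eqM.
Qed.

Section Continuous.
Variables (R S : comNzRingType) (phi : {rmorphism fps R -> fps S}).
Hypothesis phi_ford : forall n f, ford n f -> ford n (phi f).

Lemma rmorph_coef0 (g : fps R) : g 0%N = 0 -> phi g 0%N = 0.
Proof.
move=> g0; apply: (fordP 1 _ (phi_ford _)) => //.
by apply/fordP => -[].
Qed.

Lemma rmorph_qprod (a b : fps R) : b 0%N = 0 ->
  phi (qprod a b) = qprod (phi a) (phi b).
Proof.
move=> b0; apply/esym/qprod_eq => [|n]; first exact: rmorph_coef0.
have := phi_ford (ford_sym (qprod_ford n a b0)).
rewrite rmorphB rmorph_prod.
by under eq_bigr do rewrite rmorphB rmorph1 rmorphM rmorphXn.
Qed.

Lemma rmorph_finv (g : fps R) : g 0%N = 1 -> phi (finv g) = finv (phi g).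
Proof.
move=> g0; apply/esym/finv_uniq; last by rewrite -rmorphM mul_finv ?rmorph1.
have /eqP : phi (g - 1) 0%N = 0.
  by apply: rmorph_coef0; rewrite coef_fpsD coef_fpsN g0 subrr.
by rewrite rmorphB rmorph1 coef_fpsD coef_fpsN subr_eq0 => /eqP.
Qed.
End Continuous.

Section Dilation.
Variable R : comNzRingType.

(** Substitution q -> q^m, convertible to [fsub5] at m = 5. At m = 0 it keeps only the constant
    term, so it is a ring morphism for every m. *)
Definition fdil (m : nat) (f : fps R) : fps R :=
  fun n => if (m %| n)%N then f (n %/ m)%N else 0.

Lemma fdil_is_zmod_morphism m : zmod_morphism (fdil m).
Proof.
move=> f g; apply: funext => n; rewrite coef_fpsD coef_fpsN /fdil coef_fpsD coef_fpsN.
by case: ifP; rewrite ?subrr.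
Qed.

Lemma fdil_is_monoid_morphism m : monoid_morphism (fdil m).
Proof.
split=> [|f g]; apply: funext => n; rewrite /fdil.
  by rewrite !coef_fps1; case: n => [|n]; rewrite ?dvdn0 ?div0n //;
    case: ifP => // /dvdnP[[|k] e]; rewrite e // mulnK //; case: m e => //; lia.
rewrite [in RHS]coef_fpsM; case: ifPn => [m_n|not_m_n]; last first.
  rewrite big1 // => i _; case: ifP => [m_i|]; rewrite ?mul0r //.
  case: ifP => [m_ni|]; rewrite ?mulr0 //.
  by case/negP: not_m_n; rewrite -(subnKC (leq_ord i)) dvdn_add.
rewrite coef_fpsM -[in RHS](divnK m_n); set k := (n %/ m)%N.
have [m0|m_gt0] := posnP m.
  by rewrite /k m0 divn0 mul0n !big_ord1 /= divn0 subnn.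
(* With the top index k m removed, the others form k blocks of length m, each with one multiple of
   m, at its start. *)
rewrite !big_ord_recr /= dvdn_mull // !subnn dvdn0 div0n mulnK //; congr (_ + _).
rewrite (@big_ord_mul _ _ _ k m (fun i => (if (m %| i)%N then f (i %/ m)%N else 0)
  * (if (m %| k * m - i)%N then g ((k * m - i) %/ m)%N else 0))).
apply: eq_bigr => i _; rewrite (bigD1 (Ordinal m_gt0)) //= addn0 dvdn_mull //.
rewrite mulnK // -mulnBl dvdn_mull // mulnK // big1 ?addr0 // => r r0.
rewrite dvdn_addr ?dvdn_mull // gtnNdvd ?mul0r //.
by rewrite lt0n; apply: contraNneq r0 => r0; apply/eqP/val_inj.
Qed.

HB.instance Definition _ m :=
  GRing.isZmodMorphism.Build (fps R) (fps R) (fdil m) (fdil_is_zmod_morphism m).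
HB.instance Definition _ m :=
  GRing.isMonoidMorphism.Build (fps R) (fps R) (fdil m) (fdil_is_monoid_morphism m).

Lemma fdil_ford m n f : ford n f -> ford n (fdil m f).
Proof.
move=> /fordP fn; apply/fordP => i lt_in; rewrite /fdil; case: ifP => // _.
by rewrite fn // (leq_ltn_trans (leq_div i m)).
Qed.

Lemma fdil_mono m s : (0 < m)%N -> fdil m (fmono R s) = fmono R (m * s).
Proof.
move=> m_gt0; apply: funext => n; rewrite /fdil /fmono.
case: ifP => [/dvdnP[k ->]|]; first by rewrite mulnK // mulnC eqn_pmul2l.
by case: eqP => // ->; rewrite dvdn_mulr.
Qed.

Lemma fdil_const m (c : R) : fdil m (fconst c) = fconst c.
Proof.
apply: funext => -[|n]; rewrite /fdil ?dvdn0 ?div0n //.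
case: ifP => // /dvdnP[[|k] e]; rewrite e //; case: m e => [|m] e;
  first by rewrite muln0 in e.
by rewrite mulnK.
Qed.

Lemma fdil_qp m s d : (0 < m)%N -> (0 < d)%N ->
  fdil m (qp R s d) = qp R (m * s) (m * d).
Proof.
move=> m_gt0 d_gt0; rewrite /qp rmorph_qprod /=.
- by rewrite !fdil_mono.
- exact: fdil_ford.
- by rewrite /fmono ltn_eqF.
Qed.
End Dilation.

Section Twist.
Variables (R S : comNzRingType) (h : {rmorphism R -> S}) (u : S).

(** Coefficient change along h combined with X -> uX; at u = 1/z it undoes the encoding q = z t in
    [Mbar_gen]. *)
Definition ftwist (f : fps R) : fps S := fun n => h (f n) * u ^+ n.

Lemma ftwist_is_zmod_morphism : zmod_morphism ftwist.
Proof.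
by move=> f g; apply: funext => n; rewrite /ftwist coef_fpsD rmorphB mulrBl.
Qed.

Lemma ftwist_is_monoid_morphism : monoid_morphism ftwist.
Proof.
split=> [|f g]; apply: funext => n; rewrite /ftwist.
  by rewrite !coef_fps1; case: n => [|n]; rewrite ?rmorph1 ?mulr1 ?rmorph0 ?mul0r.
rewrite !coef_fpsM rmorph_sum mulr_suml; apply: eq_bigr => i _.
by rewrite rmorphM mulrACA -exprD subnKC ?leq_ord.
Qed.

HB.instance Definition _ :=
  GRing.isZmodMorphism.Build (fps R) (fps S) ftwist ftwist_is_zmod_morphism.
HB.instance Definition _ :=
  GRing.isMonoidMorphism.Build (fps R) (fps S) ftwist ftwist_is_monoid_morphism.

Lemma ftwist_ford n f : ford n f -> ford n (ftwist f).
Proof.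
by move=> /fordP fn; apply/fordP => i lt_in; rewrite /ftwist fn // rmorph0 mul0r.
Qed.
End Twist.

(** * Splitting and merging of q-products *)

Lemma qp_unit (R : comNzRingType) s d : (0 < s)%N -> qp R s d 0%N = 1.
Proof. by move=> s_gt0; rewrite /qp qprod0 /fmono eq_sym gtn_eqF // subr0. Qed.

(** The factors of (q;q) are sorted by the residue of their exponent, taken in 1..d; dilation by m
    gives the general case. *)
Lemma qp_split (R : comNzRingType) m d : (0 < m)%N -> (0 < d)%N ->
  qp R m m = \prod_(r < d) qp R (m * r.+1) (m * d).
Proof.
move=> m_gt0 d_gt0; have qp1 : qp R 1 1 = \prod_(r < d) qp R r.+1 d.
  apply: ford_eq => n.
  apply: (@ford_trans _ _ _ (\prod_(k < n * d) (1 - fmono R 1 * fmono R 1 ^+ k))).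
    by apply: fordW (qprod_ford _ _ _) => //; exact: leq_pmulr.
  rewrite (@big_ord_mul _ _ _ n d (fun k => 1 - fmono R 1 * fmono R 1 ^+ k)).
  rewrite exchange_big; apply: ford_eq_prod => r; apply: ford_sym.
  apply: ford_trans (qprod_ford n _ _) _; first by rewrite /fmono ltn_eqF.
  rewrite [X in X - _](_ : _ = \prod_(k < n) (1 - fmono R 1 * fmono R 1 ^+ (k * d
    + r))) ?subrr ?ford_zero //.
  apply: eq_bigr => k _; rewrite !fmonoX !fmonoM.
  by congr (1 - fmono _ _); lia.
rewrite -[m in LHS]muln1 -fdil_qp // qp1 rmorph_prod.
by apply: eq_bigr => r _; rewrite /= fdil_qp.
Qed.

Lemma qprod_opp_mul (R : comNzRingType) :
  qprod (- fmono R 1) (fmono R 1) * qp R 1 1 = qp R 2 2.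
Proof.
apply/esym/qprod_eq => // n; apply: ford_sym.
apply: ford_trans (ford_eqM (qprod_ford n _ _) (qprod_ford n _ _)) _ => //.
rewrite -big_split /= [X in X - _](_ : _ = \prod_(k < n) (1 - fmono R 2
  * fmono R 2 ^+ k)).
  by rewrite subrr ford_zero.
apply: eq_bigr => k _; rewrite mulNr !fmonoX !fmonoM.
have -> : fmono R (2 + 2 * k) = fmono R (1 + 1 * k) * fmono R (1 + 1 * k).
  by rewrite fmonoM; congr fmono; lia.
by ring.
Qed.

(** * Product identities at a primitive fifth root of unity *)

Section FifthRoot.
Variable F : fieldType.
Variable z : F.
Hypothesis z_prim : 5.-primitive_root z.
Local Notation X := (fmono F 1).
Local Notation Q i := (qprod (fconst (z ^+ i) * X) X).

Lemma fifth_root_neq0 : z != 0.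
Proof.
apply/eqP => z0; have /eqP := prim_expr_order z_prim.
by rewrite z0 expr0n eq_sym oner_eq0.
Qed.

(** The two Gaussian periods have sum and product -1, so they are the roots of x^2 + x - 1. *)
Lemma fifth_root_sum : z + z ^+ 4 + (z ^+ 2 + z ^+ 3) = -1.
Proof.
have z1 : z - 1 != 0.
  by rewrite subr_eq0 -[z]expr1 -(prim_order_dvd z_prim).
apply: (mulfI z1); have := prim_expr_order z_prim => z5.
have : z * z ^+ 4 = 1 by rewrite -exprS.
have -> : (z - 1) * (z + z ^+ 4 + (z ^+ 2 + z ^+ 3)) = z * z ^+ 4 - z by ring.
by move=> ->; ring.
Qed.

Lemma fifth_root_prod : (z + z ^+ 4) * (z ^+ 2 + z ^+ 3) = -1.
Proof.
rewrite -fifth_root_sum; have := prim_expr_order z_prim => z5.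
have -> : (z + z ^+ 4) * (z ^+ 2 + z ^+ 3) = z ^+ 3 + z ^+ 4 + z ^+ 5 * z
  + z ^+ 5 * z ^+ 2 by ring.
by rewrite z5; ring.
Qed.

Lemma qprod_fifth_roots :
  qp F 1 1 * (Q 1 * Q 2 * Q 3 * Q 4) = qp F 5 5.
Proof.
apply/esym/qprod_eq => // n; apply: ford_sym.
apply: ford_trans (ford_eqM (qprod_ford n _ _) (ford_eqM (ford_eqM
  (ford_eqM (qprod_ford n _ _) (qprod_ford n _ _)) (qprod_ford n _ _))
    (qprod_ford n _ _))) _ => //.
rewrite -!big_split /= [X in X - _](_ : _ = \prod_(k < n) (1 - fmono F 5
  * fmono F 5 ^+ k)).
  by rewrite subrr ford_zero.
apply: eq_bigr => k _; rewrite !rmorphXn /=; set u := fconst z.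
have -> : fmono F 5 * fmono F 5 ^+ k = (X * X ^+ k) ^+ 5.
  by rewrite !fmonoX !fmonoM fmonoX; congr fmono; lia.
set y := X * X ^+ k.
have u5 : u ^+ 5 = 1 by rewrite -rmorphXn (prim_expr_order z_prim) rmorph1.
have u_sum : u ^+ 2 + u ^+ 3 = - 1 - (u + u ^+ 4).
  by rewrite -!rmorphXn -!rmorphD
    -[- 1](rmorphN1 (@fconst F)) -rmorphB -fifth_root_sum /=; congr fconst; ring.
have u_prod : (u + u ^+ 4) * (u ^+ 2 + u ^+ 3) = - 1.
  by rewrite -!rmorphXn -!rmorphD -rmorphM fifth_root_prod rmorphN1.
(* Factor by factor this is 1 - y^5; pairing inverse roots leaves only the two periods. *)
have -> : (1 - y) * ((1 - u ^+ 1 * X * X ^+ k) * (1 - u ^+ 2 * X * X ^+ k)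
    * (1 - u ^+ 3 * X * X ^+ k) * (1 - u ^+ 4 * X * X ^+ k))
  = (1 - y) * ((1 - (u + u ^+ 4) * y + u ^+ 5 * y ^+ 2)
               * (1 - (u ^+ 2 + u ^+ 3) * y + u ^+ 5 * y ^+ 2)).
  by rewrite /y; ring.
rewrite u5 !mul1r.
have -> : (1 - (u + u ^+ 4) * y + y ^+ 2) * (1 - (u ^+ 2 + u ^+ 3) * y + y ^+ 2)
  = 1 - (u + u ^+ 4 + (u ^+ 2 + u ^+ 3)) * y * (1 + y ^+ 2)
    + (2%:R + (u + u ^+ 4) * (u ^+ 2 + u ^+ 3)) * y ^+ 2 + y ^+ 4 by ring.
by rewrite u_prod u_sum; ring.
Qed.

Local Notation c := (fconst (z + z ^+ 4)).
Local Notation d := (fconst (z ^+ 2 + z ^+ 3)).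

Lemma dissection1 : qp F 1 1 * (Q 1 * Q 4)
  = qp F 25 25 * (qp F 10 25 * qp F 15 25)
    + d * X * (qp F 25 25 * (qp F 5 25 * qp F 20 25)).
Proof.
apply: theta_dissection; first exact: prim_expr_order.
by rewrite -[z]expr1 -(prim_order_dvd z_prim).
Qed.

Lemma dissection2 : qp F 1 1 * (Q 2 * Q 3)
  = qp F 25 25 * (qp F 10 25 * qp F 15 25)
    + c * X * (qp F 25 25 * (qp F 5 25 * qp F 20 25)).
Proof.
have z5 := prim_expr_order z_prim.
have := @theta_dissection _ (z ^+ 2); rewrite -!exprM.
have -> : z ^+ (2 * 4) = z ^+ 3 by rewrite (exprD z 5 3) z5 mul1r.
have -> : z ^+ (2 * 3) = z by rewrite (exprD z 5 1) z5 mul1r.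
rewrite [z ^+ 4 + z]addrC; apply.
  by rewrite (exprD z 5 5) z5 mulr1.
by rewrite -(prim_order_dvd z_prim).
Qed.

Lemma qp_split5 m : (0 < m)%N ->
  qp F m m = qp F m (5 * m) * qp F (4 * m) (5 * m)
    * (qp F (2 * m) (5 * m) * qp F (3 * m) (5 * m)) * qp F (5 * m) (5 * m).
Proof.
move=> m_gt0; rewrite (@qp_split _ m 5) // !big_ord_recr big_ord0 /=.
by rewrite ![(m * _)%N]mulnC mul1n; ring.
Qed.

(** After q -> q^2 the series A and B become T e and T f with T = (q^50;q^50), and (q^10;q^10) = e f
    T, so one factor T cancels. *)
Lemma euler_dissection : let e := qp F 20 50 * qp F 30 50 in
  let f := qp F 10 50 * qp F 40 50 in
  qp F 2 2 * (e * f) = qp F 50 50 * (e ^+ 2 - fmono F 2 * e * f - fmono F 4 * f ^+ 2).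
Proof.
set e := _ * _; set f := _ * _; move=> /=.
set T := qp F 50 50.
have E1 : qp F 2 2 * fdil 2 (Q 1 * Q 4) = T * e + d * fmono F 2 * (T * f).
  have := congr1 (fdil 2) dissection1; move: (fdil_const 2 (z ^+ 2 + z ^+ 3)).
  (* Abstracting the constant and the twisted products keeps the morphism rules from splitting
     them. *)
  move: d (_ * Q _) => w Qs fw.
  by rewrite !(rmorphM, rmorphD) /= fw !fdil_qp // fdil_mono.
have E2 : qp F 2 2 * fdil 2 (Q 2 * Q 3) = T * e + c * fmono F 2 * (T * f).
  have := congr1 (fdil 2) dissection2; move: (fdil_const 2 (z + z ^+ 4)).
  move: c (_ * Q _) => w Qs fw.
  by rewrite !(rmorphM, rmorphD) /= fw !fdil_qp // fdil_mono.
have E3 : qp F 2 2 * (fdil 2 (Q 1 * Q 4) * fdil 2 (Q 2 * Q 3)) = e * f * T.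
  have := congr1 (fdil 2) qprod_fifth_roots.
  have -> : Q 1 * Q 2 * Q 3 * Q 4 = (Q 1 * Q 4) * (Q 2 * Q 3) by ring.
  move: (Q 1 * Q 4) (Q 2 * Q 3) => Q14 Q23; rewrite !rmorphM /= !fdil_qp // => ->.
  have -> : qp F (2 * 5) (2 * 5) = f * e * T := @qp_split5 10 isT.
  by ring.
have cd : c + d = -1 by rewrite -rmorphD fifth_root_sum rmorphN1.
have cdM : c * d = -1 by rewrite -rmorphM fifth_root_prod rmorphN1.
apply: (@fps_cancel _ T); first exact: qp_unit.
have -> : T * (qp F 2 2 * (e * f)) = qp F 2 2 * (e * f * T) by ring.
rewrite -E3.
transitivity ((T * e + d * fmono F 2 * (T * f)) * (T * e + c * fmono F 2 * (T * f))).
  by rewrite -E1 -E2; ring.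
transitivity (T ^+ 2 * (e ^+ 2 + (c + d) * fmono F 2 * e * f
  + (c * d) * (fmono F 2 * fmono F 2) * f ^+ 2)); first by ring.
by rewrite cd cdM fmonoM; ring.
Qed.

(** Denominators are cleared: a b (q^25;q^25) = (q^5;q^5), and (q^5;q^5) G = (q^2;q^2) (q;q) (z^2
    q;q) (z^3 q;q). *)
Lemma rank_dissection G : let a := qp F 5 25 * qp F 20 25 in
  let b := qp F 10 25 * qp F 15 25 in
  let e := qp F 20 50 * qp F 30 50 in
  let f := qp F 10 50 * qp F 40 50 in
  Q 1 * Q 4 * G = qp F 2 2 ->
  a * b * (e * f) * G
  = qp F 50 50 * (e ^+ 2 - fmono F 2 * e * f - fmono F 4 * f ^+ 2) * (b + c * X * a).
Proof.
set a := _ * _; set b := _ * _; set e := _ * _; set f := _ * _; move=> /= GE.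
apply: (@fps_cancel _ (qp F 25 25)); first exact: qp_unit.
have E5 : a * b * qp F 25 25 = qp F 5 5 := esym (@qp_split5 5 isT).
rewrite -euler_dissection -/e -/f -GE.
transitivity (qp F 5 5 * (e * f) * G); first by rewrite -E5; ring.
rewrite -qprod_fifth_roots.
transitivity (Q 1 * Q 4 * G * (e * f) * (qp F 1 1 * (Q 2 * Q 3))); first by ring.
by rewrite dissection2 -/a -/b; ring.
Qed.
End FifthRoot.

(** * Specialization of the generating function at z *)

Section Specialization.
Variable z : algC.
Hypothesis z_prim : 5.-primitive_root z.
Local Notation X := (fmono algC 1).

Let h : {rmorphism {poly int} -> algC}
  := horner_eval z \o map_poly (intr : int -> algC).

(** The n-th coefficient of [Mbar_gen] carries an extra z^n, which the factor z^(-n) of the twist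
    removes. *)
Lemma Mbar_at_twist : Mbar_at z = ftwist h (z ^-1) Mbar_gen.
Proof.
have z0 := fifth_root_neq0 z_prim.
apply: funext => n; rewrite /Mbar_at /ftwist /h /= /horner_eval.
set p := Mbar_gen n.
rewrite (@horner_coef_wide _ (size p)) ?size_poly // mulr_suml.
apply: eq_bigr => j _; rewrite /Mbar subrK /= -/p coef_map /=.
by rewrite expfzDr // -exprnP -exprnN -mulrA exprVn.
Qed.


Lemma twist_Mbar_gen :
  qprod (fconst (z ^+ 1) * X) X * qprod (fconst (z ^+ 4) * X) X
    * ftwist h z^-1 Mbar_gen = qp algC 2 2.
Proof.
have z0 := fifth_root_neq0 z_prim.
have zV : z^-1 = z ^+ 4.
  by apply: (mulfI z0); rewrite mulfV // -exprS (prim_expr_order z_prim).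
have hX : h 'X = z by rewrite /h /= map_polyX /horner_eval hornerX.
pose phi : {rmorphism fps {poly int} -> fps algC} := ftwist h z^-1.
rewrite -[ftwist _ _ _]/(phi Mbar_gen).
have phiZt : phi Zt = X.
  apply: funext => -[|[|n]];
    rewrite /phi /ftwist /Zt /fmono /= /ftwist /= ?rmorph0 ?mul0r //.
  by rewrite -[LHS]/(h 'X * z^-1 ^+ 1) hX expr1 mulfV.
have phiTt : phi Tt = fconst (z ^+ 4) * X.
  apply: funext => -[|[|n]];
    rewrite coef_fconstM /phi /ftwist /Tt /fmono /= /ftwist /= ?rmorph0 ?mul0r
    ?mulr0 //.
  by rewrite -[LHS]/(h 1 * z^-1 ^+ 1) rmorph1 mul1r zV expr1 mulr1.
have phiZc : phi Zc = fconst (z ^+ 1).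
  apply: funext => -[|n];
    rewrite /phi /ftwist /Zc /fconst /= /ftwist /= ?rmorph0 ?mul0r //.
  by rewrite -[LHS]/(h 'X * z^-1 ^+ 0) hX mulr1 expr1.
have phi_ford n g : ford n g -> ford n (phi g) by exact: ftwist_ford.
pose N := qprod (- Zt) Zt * qprod Zt Zt.
pose D := qprod (Zc * Zt) Zt * qprod Tt Zt.
have D0 : D 0%N = 1.
  by rewrite /D coef0_fpsM !qprod0 coef0_fpsM /Zt /Tt /fmono /= mulr0 !subr0 mulr1.
(* The denominator is cleared before the morphism is applied, so only products have to be
   transported. *)
have : D * Mbar_gen = N.
  rewrite /Mbar_gen /fdiv.
  by rewrite -[fmul _ (finv _)]/(N * finv D) mulrCA mul_finv // mulr1.
move/(congr1 phi); rewrite /D /N !(rmorphM phi) !(rmorph_qprod phi_ford)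
  // rmorphM rmorphN.
by rewrite phiZt phiTt phiZc => ->; exact: qprod_opp_mul.
Qed.
End Specialization.


(** * The five components after q -> q^5 *)

Section DilatedQuotients.
Variable z : algC.
Local Notation P s d := (qp algC s d).
Local Notation c := (fconst (z + z ^+ 4)).

Lemma fdil_finv m (g : fps algC) : g 0%N = 1 ->
  fdil m (finv g) = finv (fdil m g).
Proof. by move=> g0; rewrite -rmorph_finv //; exact: fdil_ford. Qed.

Lemma fdil_Mbar05 : fdil 5 (Mbar05 z)
  = P 20 50 * (P 30 50 * P 50 50)
      * finv (P 5 25 * P 20 25 * (P 10 50 * P 40 50))
    - c * (fmono algC 5 * (P 10 50 * (P 40 50 * P 50 50)
      * finv (P 10 25 * P 15 25 * (P 20 50 * P 30 50)))).
Proof.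
rewrite /Mbar05 /fdiv !fmulE fsubE rmorphB !rmorphM /= !fdil_finv;
  try by rewrite !coef0_fpsM !qp_unit ?mulr1.
by rewrite !rmorphM /= !fdil_qp // fdil_const fdil_mono.
Qed.

Lemma fdil_Mbar15 : fdil 5 (Mbar15 z)
  = c * (P 20 50 * (P 30 50 * P 50 50)
      * finv (P 10 25 * P 15 25 * (P 10 50 * P 40 50))).
Proof.
rewrite /Mbar15 /fdiv !fmulE !rmorphM /= !fdil_finv;
  try by rewrite !coef0_fpsM !qp_unit ?mulr1.
by rewrite !rmorphM /= !fdil_qp // fdil_const.
Qed.

Lemma fdil_Mbar25 :
  fdil 5 (Mbar25) = - (P 50 50 * finv (P 5 25 * P 20 25)).
Proof.
rewrite /Mbar25 /fdiv !fmulE foppE rmorphN !rmorphM /= !fdil_finv;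
  try by rewrite !coef0_fpsM !qp_unit ?mulr1.
by rewrite !rmorphM /= !fdil_qp //.
Qed.

Lemma fdil_Mbar35 :
  fdil 5 (Mbar35 z) = - (c * (P 50 50 * finv (P 10 25 * P 15 25))).
Proof.
rewrite /Mbar35 /fdiv !fmulE foppE rmorphN !rmorphM /= !fdil_finv;
  try by rewrite !coef0_fpsM !qp_unit ?mulr1.
by rewrite !rmorphM /= !fdil_qp // fdil_const.
Qed.

Lemma fdil_Mbar45 : fdil 5 (Mbar45)
  = - (P 10 50 * (P 40 50 * P 50 50)
      * finv (P 5 25 * P 20 25 * (P 20 50 * P 30 50))).
Proof.
rewrite /Mbar45 /fdiv !fmulE foppE rmorphN !rmorphM /= !fdil_finv;
  try by rewrite !coef0_fpsM !qp_unit ?mulr1.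
by rewrite !rmorphM /= !fdil_qp //.
Qed.
End DilatedQuotients.

Theorem theorem2p10 (zeta : algC) (hz : 5.-primitive_root zeta) :
  forall n : nat,
    Mbar_at zeta n =
    \sum_(r < 5) fmul (fmono algC r) (fsub5 (Mbar_r5 zeta r)) n.
Proof.
move=> n.
pose M (r : nat) := fmono algC r * fdil 5 (Mbar_r5 zeta r).
(* The summands agree by conversion between [fdil 5] and [fsub5]. *)
suff -> : Mbar_at zeta = \sum_(r < 5) M r by rewrite coef_fps_sum.
rewrite !big_ord_recr big_ord0 /M /=; rewrite add0r.
rewrite fdil_Mbar05 fdil_Mbar15 fdil_Mbar25 fdil_Mbar35 fdil_Mbar45 fmono0.
set a := qp _ 5 25 * qp _ 20 25; set b := qp _ 10 25 * qp _ 15 25.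
set e := qp _ 20 50 * qp _ 30 50; set f := qp _ 10 50 * qp _ 40 50.
set T := qp _ 50 50; set c := fconst _; set G := Mbar_at _.
have GE : a * b * (e * f) * G
    = T * (e ^+ 2 - fmono algC 2 * e * f - fmono algC 4 * f ^+ 2)
      * (b + c * fmono algC 1 * a).
  by rewrite /G Mbar_at_twist //; exact: rank_dissection (twist_Mbar_gen hz).
have [a0 b0 e0 f0] : [/\ a 0%N = 1, b 0%N = 1, e 0%N = 1 & f 0%N = 1].
  by split; rewrite /a /b /e /f coef0_fpsM !qp_unit ?mulr1.
have inv2 (g g' : fps algC) : g 0%N = 1 -> g' 0%N = 1 -> g * g' * finv (g * g') = 1.
  by move=> g0 g0'; rewrite mul_finv // coef0_fpsM g0 g0' mulr1.
move: (inv2 _ _ a0 f0) (inv2 _ _ b0 e0) (inv2 _ _ b0 f0) (inv2 _ _ a0 e0).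
move: (mul_finv a0) (mul_finv b0) => ia ib iaf ibe ibf iae.
apply: (@fps_cancel _ (a * b * (e * f))).
  by rewrite !coef0_fpsM a0 b0 e0 f0 !mulr1.
rewrite GE.
(* Expanding (e^2 - q^2 e f - q^4 f^2)(b + c q a) gives six terms; those with e^2 b and q^5 f^2 a
   both lie in residue 0. Each is multiplied by the form of 1 that matches the denominator of its
   component. *)
transitivity (T * e ^+ 2 * b * (a * f * finv (a * f))
  - c * fmono algC 5 * T * f ^+ 2 * a * (b * e * finv (b * e))
  + fmono algC 1 * c * T * e ^+ 2 * a * (b * f * finv (b * f))
  - fmono algC 2 * T * b * e * f * (a * finv a)
  - fmono algC 3 * c * T * a * e * f * (b * finv b)
  - fmono algC 4 * T * f ^+ 2 * b * (a * e * finv (a * e))).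
  rewrite ia ib iaf ibe ibf iae -[fmono algC 5](fmonoM _ 4 1)
    -[fmono algC 3](fmonoM _ 2 1).
  by ring.
by rewrite ![qp _ _ _ * (_ * T)]mulrA -/e -/f; ring.
Qed.
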